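(* For every $\alpha \in (0,1)$ there exists a strictly ergodic subshift $X$ (over a finite alphabet, with the shift map $\sigma$) whose topological entropy dimension equals $\alpha$.
   Context: A subshift is a closed shift-invariant subset $X$ of $\mathcal{A}^{\mathbb{Z}}$ for a finite alphabet $\mathcal{A}$, with the left shift $\sigma$. It is strictly ergodic if it is minimal and uniquely ergodic. Let $\mathcal{B}_n(X)$ be the set of words of length $n$ occurring in points of $X$. The topological upper (resp. lower) entropy dimension of $X$ is the unique value $c\in[0,\infty]$ such that $\limsup_{n\to\infty} \frac{\log|\mathcal{B}_n(X)|}{n^{\beta}}$ (resp. with $\liminf$) equals $\infty$ for all $0<\beta<c$ and equals $0$ for all $\beta > c$. If the upper and lower entropy dimensions coincide, the common value is the topological entropy dimension of $X$. *)

(* Defs.v *)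
From HB Require Import structures.
From mathcomp Require Import all_boot all_order all_algebra.
From mathcomp Require Import all_classical all_reals all_analysis.
Set Implicit Arguments. Unset Strict Implicit. Unset Printing Implicit Defensive.
Import Order.TTheory GRing.Theory Num.Theory.
Local Open Scope classical_set_scope.
Local Open Scope ring_scope.

(* Configurations over a finite alphabet A, indexed by the integers.
   The extra (phantom) argument a0 only serves to equip the type with a
   point, as required by MathComp-Analysis' generated sigma-algebras. *)
Definition config (A : finType) (a0 : A) : Type := int -> A.
HB.instance Definition _ (A : finType) (a0 : A) :=
  Choice.on (config a0).
HB.instance Definition _ (A : finType) (a0 : A) :=
  isPointed.Build (config a0) (fun _ => a0).

Definition shift (A : finType) (a0 : A) (x : config a0) : config a0 :=
  fun n => x (n + 1).

(* closedness in the product topology of discrete A (A^Z):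
   x is in X as soon as every central window of x is matched by a point of X *)
Definition closed_conf (A : finType) (a0 : A) (X : set (config a0)) : Prop :=
  forall x : config a0,
    (forall N : nat, exists2 y, X y &
       forall n : int, `|n| <= N%:Z -> y n = x n) -> X x.

Definition shift_invariant (A : finType) (a0 : A) (X : set (config a0)) : Prop :=
  forall x, X x <-> X (shift x).

Definition subshift (A : finType) (a0 : A) (X : set (config a0)) : Prop :=
  X !=set0 /\ closed_conf X /\ shift_invariant X.

Definition minimal_subshift (A : finType) (a0 : A) (X : set (config a0)) : Prop :=
  subshift X /\ forall Y, subshift Y -> Y `<=` X -> Y = X.

(* cylinder generators and the cylinder (= Borel) sigma-algebra on A^Z *)
Definition cylinders (A : finType) (a0 : A) : set (set (config a0)) :=
  [set C | exists (i : int) (a : A), C = [set x : config a0 | x i = a]].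

Definition cylT (A : finType) (a0 : A) := g_sigma_algebraType (@cylinders A a0).

Definition invariant_prob (R : realType) (A : finType) (a0 : A)
  (X : set (config a0)) (P : probability (cylT a0) R) : Prop :=
  P X = 1%E /\
  forall B : set (cylT a0), measurable B -> P (@shift A a0 @^-1` B) = P B.

Definition uniquely_ergodic (R : realType) (A : finType) (a0 : A)
  (X : set (config a0)) : Prop :=
  (exists P : probability (cylT a0) R, invariant_prob X P) /\
  forall P Q : probability (cylT a0) R, invariant_prob X P -> invariant_prob X Q ->
    forall B : set (cylT a0), measurable B -> P B = Q B.

Definition strictly_ergodic (R : realType) (A : finType) (a0 : A)
  (X : set (config a0)) : Prop :=
  minimal_subshift X /\ uniquely_ergodic R X.

Definition language (A : finType) (a0 : A) (X : set (config a0)) (n : nat)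
  : {set n.-tuple A} :=
  [set w : n.-tuple A | `[< exists2 x : config a0, X x &
      exists i : int, forall k : 'I_n, x (i + (k : nat)%:Z) = tnth w k >]].

Definition cplx_ratio (R : realType) (A : finType) (a0 : A)
  (X : set (config a0)) (beta : R) : (\bar R)^nat :=
  fun n => (ln (#|language X n|%:R) / (n%:R `^ beta))%:E.

Definition upper_entropy_dim (R : realType) (A : finType) (a0 : A)
  (X : set (config a0)) (c : \bar R) : Prop :=
  (forall beta : R, 0 < beta -> (beta%:E < c)%E ->
      limn_esup (cplx_ratio X beta) = +oo%E) /\
  (forall beta : R, 0 < beta -> (c < beta%:E)%E ->
      limn_esup (cplx_ratio X beta) = 0%E).

Definition lower_entropy_dim (R : realType) (A : finType) (a0 : A)
  (X : set (config a0)) (c : \bar R) : Prop :=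
  (forall beta : R, 0 < beta -> (beta%:E < c)%E ->
      limn_einf (cplx_ratio X beta) = +oo%E) /\
  (forall beta : R, 0 < beta -> (c < beta%:E)%E ->
      limn_einf (cplx_ratio X beta) = 0%E).

Definition entropy_dim (R : realType) (A : finType) (a0 : A)
  (X : set (config a0)) (c : \bar R) : Prop :=
  upper_entropy_dim X c /\ lower_entropy_dim X c.

(* Main.v *)
(** The subshift is generated by a regular Toeplitz sequence.  Skeletons S_j of
    length 2^j with q_j holes are built from S_0 = one hole: S_(j+1) is either
    S_j S_j, or S_j followed by S_j with its holes filled by a prescribed word.
    Doubling the holes exactly when floor (alpha j) increases gives
    q_j = 2^(floor (alpha j)).  Every finite word serves as a filling at
    arbitrarily high levels, so all 2^(q_j) fillings of S_j occur, with bounded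
    gaps; hence minimality, and log of the number of words of length n lies
    between constant multiples of n^alpha.  As q_j / 2^j -> 0, the number of
    occurrences of a pattern in a window of length 2^j is determined by S_j up
    to an error o(2^j), whence unique ergodicity.  The invariant measure is the
    image of Lebesgue measure on [0, 1[, viewed as the binary odometer, under
    the almost everywhere defined map reading the Toeplitz sequence from a
    point of the odometer. *)

Require Import Defs.
From HB Require Import structures.
From mathcomp Require Import all_boot all_order all_algebra.
From mathcomp Require Import all_classical all_reals all_analysis.
From mathcomp Require Import measurable_realfun zify lra.
Import Order.TTheory GRing.Theory Num.Theory.
Local Open Scope classical_set_scope.
Local Open Scope ring_scope.

(** * Skeletons and the Toeplitz sequence *)

Section Skeleton.
Local Open Scope nat_scope.
(* The second half of skeleton i.+1 is skeleton i with holes filled by e i when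
   [fill i], and a copy of skeleton i with fresh holes otherwise. *)
Variables (fill : nat -> bool) (e : nat -> nat -> bool).

Fixpoint holes (j : nat) : nat :=
  if j is i.+1 then (if fill i then holes i else (holes i).*2) else 1.

Fixpoint nfill (j : nat) : nat :=
  if j is i.+1 then nfill i + fill i else 0.

(* The word of length 2 ^ j obtained by writing s 0, s 1, ... in the holes of
   the j-th skeleton; positions p >= 2 ^ j are junk. *)
Fixpoint word (j : nat) (s : nat -> bool) (p : nat) : bool :=
  if j is i.+1 then
    if p < 2 ^ i then word i s p
    else if fill i then word i (e i) (p - 2 ^ i)
    else word i (fun k => s (holes i + k)) (p - 2 ^ i)
  else s 0.

(* [det j p]: position p of the j-th skeleton is not a hole. *)
Fixpoint det (j p : nat) : bool :=
  if j is i.+1 then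
    if p < 2 ^ i then det i p else fill i || det i (p - 2 ^ i)
  else false.

(** Level [p] is high enough since [p < 2 ^ p], and prefixes do not change with the level. Only
    second halves get filled, so a hole of a prefix stays a hole at all later levels; such positions
    receive the default [false]. *)
Definition toeplitz (p : nat) : bool := word p (fun=> false) p.

(** Each level doubles the length, and the holes as well unless it is a filling level. The density
    of holes is thus [2 ^ - nfill j]. *)
Lemma holes_nfill j : holes j * 2 ^ nfill j = 2 ^ j.
Proof.
elim: j => [//|j IH] /=; case: (fill j); rewrite ?addn1 ?addn0 !expnS.
- by rewrite mulnCA IH.
- by rewrite -mul2n -mulnA IH.
Qed.

Lemma holes_gt0 j : 0 < holes j.
Proof. by have := expn_gt0 2 j; rewrite -holes_nfill; case: (holes j). Qed.

Lemma eq_word j s s' : (forall i, i < holes j -> s i = s' i) -> word j s =1 word j s'.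
Proof.
elim: j s s' => [|j IH] s s' /= ss' p; first exact: ss'.
case: ltnP => _.
  by apply: IH => i ij; apply: ss'; case: (fill j) => //; lia.
case: (fill j) ss' => // ss'.
by apply: IH => i ij; apply: ss'; lia.
Qed.

Lemma word_inj j s s' : (forall p, p < 2 ^ j -> word j s p = word j s' p) ->
  forall i, i < holes j -> s i = s' i.
Proof.
elim: j s s' => [|j IH] s s' ss' i /=; first by rewrite ltnS leqn0 => /eqP ->; exact: (ss' 0).
have ss1 k : k < holes j -> s k = s' k.
  apply: IH => p pj; have /= := ss' p; rewrite pj; apply.
  by rewrite expnS; lia.
case fj: (fill j) => ij; first exact: ss1.
have [/ss1//|ji] := ltnP i (holes j).
rewrite -(subnKC ji); apply: (IH (fun k => s (holes j + k)) (fun k => s' (holes j + k))); last lia.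
move=> p pj; have /= := ss' (2 ^ j + p).
by rewrite fj (leq_gtF (leq_addr p _)) addKn; apply; rewrite expnS; lia.
Qed.

Lemma word_det j s s' p : det j p -> word j s p = word j s' p.
Proof.
elim: j s s' p => [//|j IH] s s' p /=; case: ltnP => _; first exact: IH.
by case: (fill j) => //=; exact: IH.
Qed.

Lemma word_prefix j k s p : j <= k -> p < 2 ^ j -> word k s p = word j s p.
Proof.
move=> jk pj; rewrite -(subnK jk); elim: (k - j) => //= d ->.
by rewrite (leq_trans pj) // leq_exp2l // leq_addl.
Qed.

(** By induction on the level: an aligned block lies in one half of the word, and either half is a
    filling of the skeleton one level below. *)
Lemma word_block j k s i : j <= k -> i.+1 * 2 ^ j <= 2 ^ k ->
  exists s', forall p, p < 2 ^ j -> word k s (i * 2 ^ j + p) = word j s' p.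
Proof.
move=> jk; rewrite -(subnK jk); elim: (k - j) s i => [|d IH] s i /=.
  rewrite add0n -[leqRHS]mul1n leq_mul2r expn_eq0 /= ltnS leqn0 => /eqP ->.
  by exists s => p _; rewrite mul0n.
have h0 := expn_gt0 2 j.
have dE : 2 ^ (d + j) = 2 ^ d * 2 ^ j by rewrite expnD.
rewrite addSn expnS {1}dE mulnA leq_mul2r expn_eq0 /= => id.
have [iLd|dLi] := ltnP i (2 ^ d).
  have [|s' hs'] := IH s i; first by rewrite dE leq_mul2r iLd orbT.
  exists s' => p pj; rewrite (_ : (_ < _) = true); first exact: hs'.
  by rewrite dE; nia.
have iE : i * 2 ^ j - 2 ^ (d + j) = (i - 2 ^ d) * 2 ^ j by rewrite dE mulnBl.
have le2 p : (i * 2 ^ j + p < 2 ^ (d + j)) = false.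
  by apply/negbTE; rewrite -leqNgt dE; nia.
have subE p : i * 2 ^ j + p - 2 ^ (d + j) = (i - 2 ^ d) * 2 ^ j + p.
  by rewrite -iE dE addnBAC //; nia.
have id' : (i - 2 ^ d).+1 * 2 ^ j <= 2 ^ (d + j) by rewrite dE leq_mul2r; lia.
have [fd|fd] := boolP (fill (d + j)).
  have [s' hs'] := IH (e (d + j)) _ id'.
  by exists s' => p pj; rewrite le2 subE /=; exact: hs'.
have [s' hs'] := IH (fun k => s (holes (d + j) + k)) _ id'.
by exists s' => p pj; rewrite le2 subE /=; exact: hs'.
Qed.

Lemma word_block_mod j k s r : j <= k -> r < 2 ^ k ->
  exists s', word k s r = word j s' (r %% 2 ^ j).
Proof.
move=> jk rk; have j0 := expn_gt0 2 j.
have [|s' hs'] := @word_block j k s (r %/ 2 ^ j) jk.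
  by rewrite -(subnK jk) expnD leq_mul2r expn_eq0 /= ltn_divLR // -expnD subnK.
by exists s'; have := hs' _ (ltn_pmod r j0); rewrite -divn_eq.
Qed.

Lemma toeplitzE j p : p < 2 ^ j -> toeplitz p = word j (fun=> false) p.
Proof.
move=> pj; rewrite /toeplitz; case: (leqP j p) => [jp|/ltnW pj'].
  exact: word_prefix.
by rewrite [RHS](@word_prefix p) // ltn_expl.
Qed.

Lemma toeplitz_block j i :
  exists s, forall p, p < 2 ^ j -> toeplitz (i * 2 ^ j + p) = word j s p.
Proof.
have j0 := expn_gt0 2 j.
have i1 : i.+1 * 2 ^ j <= 2 ^ (i.+1 + j) by rewrite expnD leq_mul2r ltnW ?orbT // ltn_expl.
have [s hs] := @word_block j (i.+1 + j) (fun=> false) i (leq_addl _ _) i1.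
by exists s => p pj; rewrite (@toeplitzE (i.+1 + j)); [exact: hs|nia].
Qed.

(** The Toeplitz property: off the holes of skeleton [j], letters repeat with period [2 ^ j]. *)
Lemma toeplitz_mod j p : det j (p %% 2 ^ j) ->
  toeplitz p = word j (fun=> false) (p %% 2 ^ j).
Proof.
move=> dp; have [s hs] := toeplitz_block j (p %/ 2 ^ j).
rewrite {1}(divn_eq p (2 ^ j)) hs ?ltn_pmod ?expn_gt0 //; exact: word_det.
Qed.

Lemma toeplitz_fill j i p : fill j -> p < 2 ^ j ->
  toeplitz (i * 2 ^ j.+1 + 2 ^ j + p) = word j (e j) p.
Proof.
move=> fj pj; have [s hs] := toeplitz_block j.+1 i.
rewrite -addnA hs ?expnS; last lia.
by rewrite /= fj (leq_gtF (leq_addr p _)) addKn.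
Qed.

Lemma sum_undet j : \sum_(0 <= p < 2 ^ j) ~~ det j p = holes j.
Proof.
elim: j => [|j IH]; first by rewrite expn0 big_nat1.
rewrite expnS mul2n -addnn (big_cat_nat _ (n := 2 ^ j)) ?leq_addr //=.
under eq_big_nat => i /andP[_ ij] do rewrite ij.
rewrite IH; set S := (X in _ + X = _).
have -> : S = \sum_(0 <= p < 2 ^ j) ~~ (fill j || det j p).
  rewrite /S -[X in \sum_(X <= _ < _) _]add0n big_addn addnK.
  by apply: eq_bigr => i _; rewrite (leq_gtF (leq_addl i _)) addnK.
case: (fill j) => /=; first by rewrite big1_eq addn0.
by rewrite IH addnn.
Qed.

End Skeleton.

(** * Minimality and word counts *)

Lemma iter_shift (A : finType) (a0 : A) (x : config a0) (k : nat) (n : int) :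
  iter k (@Defs.shift A a0) x n = x (n + k%:Z).
Proof.
elim: k n => [|k IH] n /=; first by rewrite addr0.
by rewrite /Defs.shift IH -addrA intS.
Qed.

Lemma iter_shift_invariant (A : finType) (a0 : A) (X : set (config a0)) x (k : nat) :
  shift_invariant X -> X x -> X (iter k (@Defs.shift A a0) x).
Proof. by move=> sX Xx; elim: k => //= k; apply: (sX _).1. Qed.

Section ToeplitzShift.
Variables (fill : nat -> bool) (e : nat -> nat -> bool).
Notation T := (toeplitz fill e).
Notation word := (word fill e).

(** Two-sided limit points of the one-sided sequence [T]. The condition [N <= o] keeps [o + n]
    nonnegative, so that [absz] is harmless. *)
Definition toeplitz_shift : set (config false) :=
  [set x | forall N : nat, exists2 o : nat, (N <= o)%N &
    forall n : int, `|n| <= N%:Z -> x n = T (absz (o%:Z + n))].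

Lemma toeplitz_shift_closed : closed_conf toeplitz_shift.
Proof.
move=> x hx N; have [y Xy yx] := hx N; have [ o No hy] := Xy N.
by exists o => // n nN; rewrite -yx // hy.
Qed.

Lemma toeplitz_shift_invariant : shift_invariant toeplitz_shift.
Proof.
move=> x; split=> hx N; have [ o No ho] := hx N.+1.
  exists o.+1; first lia.
  move=> n nN; rewrite /Defs.shift ho; last lia.
  by congr T; lia.
exists o.-1; first lia.
move=> n nN; have := ho (n - 1); rewrite /Defs.shift subrK => ->; last lia.
by congr T; lia.
Qed.

Hypothesis rich : forall (s : nat -> bool) h k,
  exists j, [/\ (k <= j)%N, fill j & forall i, (i < h)%N -> e j i = s i].

(** Some filling level [l >= j] prescribes a word starting with [s], so the second half of every
    aligned block of length [2 ^ l.+1] starts with skeleton [j] filled by [s]. *)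
Lemma toeplitz_recurrent j s :
  exists M : nat, forall i : nat, exists2 d, (d <= M)%N &
    forall k, (k < 2 ^ j)%N -> T (i + d + k)%N = word j s k.
Proof.
have [l [jl fl el]] := rich s (holes fill j) j.
exists (2 * 2 ^ l.+1)%N => i; have l0 := expn_gt0 2 l.
have := divn_eq i (2 ^ l.+1); have := ltn_pmod i (expn_gt0 2 l.+1).
set q := (i %/ _)%N; set r := (i %% _)%N => rl iE.
(* With this gap, [i + d] is the middle of the next aligned block after the one containing [i]. *)
exists (q.+1 * 2 ^ l.+1 + 2 ^ l - i)%N; first by rewrite expnS in rl iE *; nia.
move=> k kj; rewrite subnKC; last by rewrite expnS in rl iE *; nia.
rewrite toeplitz_fill //; last by rewrite (leq_trans kj) // leq_exp2l.
by rewrite (@word_prefix _ _ j l) //; apply: eq_word.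
Qed.

Lemma toeplitz_shift_word x j s : toeplitz_shift x ->
  exists i : nat, forall k : nat, (k < 2 ^ j)%N -> x (i%:Z + k%:Z) = word j s k.
Proof.
move=> Xx; have [M hM] := toeplitz_recurrent j s.
have [ o _ ho] := Xx (M + 2 ^ j)%N; have [d dM hd] := hM o.
exists d => k kj; rewrite ho; last by move: (2 ^ j)%N kj => ?; lia.
by rewrite -hd //; congr T; lia.
Qed.

Lemma toeplitz_shift_factor x m : toeplitz_shift x ->
  exists i : nat, forall k : nat, (k < m)%N -> x (i%:Z + k%:Z) = T k.
Proof.
move=> Xx; have [i hi] := toeplitz_shift_word _ m (fun=> false) Xx.
have lt2 k : (k < m -> k < 2 ^ m)%N by move=> km; rewrite (ltn_trans km) // ltn_expl.
by exists i => k /lt2 km; rewrite hi // -toeplitzE.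
Qed.

(** Every point contains every prefix of [T], hence every window of every other point; shifts of a
    single point of [Y] therefore approximate any [x]. *)
Lemma toeplitz_shift_minimal : toeplitz_shift !=set0 -> minimal_subshift toeplitz_shift.
Proof.
move=> X0; split.
  by split=> //; split; [exact: toeplitz_shift_closed|exact: toeplitz_shift_invariant].
move=> Y [[z Yz] [cY sY]] YX; apply/seteqP; split=> // x Xx.
apply: cY => N; have [ o No ho] := Xx N.
have [i hi] := toeplitz_shift_factor _ (o + N.+1) (YX _ Yz).
exists (iter (i + o) (@Defs.shift _ _) z); first exact: iter_shift_invariant.
move=> n nN; rewrite iter_shift ho // -hi; last lia.
by congr (z _); lia.
Qed.

(** * Counting words through the skeletons *)

Lemma toeplitz_languageP n (w : n.-tuple bool) : toeplitz_shift !=set0 ->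
  reflect (exists o : nat, forall k : 'I_n, T (o + k)%N = tnth w k)
    (w \in language toeplitz_shift n).
Proof.
move=> X0; rewrite inE; apply: (iffP (asboolP _)).
  move=> [x Xx [i hi]]; have [ o No ho] := Xx (absz i + n)%N.
  exists (absz (o%:Z + i)) => k; rewrite -hi ho; last by have := ltn_ord k; lia.
  by congr T; have := ltn_ord k; lia.
move=> [ o ho]; have [x0 Xx0] := X0; have [i hi] := toeplitz_shift_factor _ (o + n) Xx0.
exists x0 => //; exists (i + o)%N%:Z => k; rewrite -ho -hi; last by rewrite ltn_add2l.
by congr (x0 _); lia.
Qed.

(** By recurrence every filling of skeleton [j] occurs in [T], and different fillings give different
    words; extend each occurrence to length [n]. *)
Lemma language_lower j n : toeplitz_shift !=set0 -> (2 ^ j <= n)%N ->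
  (2 ^ holes fill j <= #|language toeplitz_shift n|)%N.
Proof.
move=> X0 jn.
pose f (s : (holes fill j).-tuple bool) := nth false s.
have occ s : {o : nat | forall k, (k < 2 ^ j)%N -> T (o + k)%N = word j (f s) k}.
  apply: cid; have [M /(_ 0%N)[d _ hd]] := toeplitz_recurrent j (f s).
  by exists d => k /hd; rewrite add0n.
pose g s : n.-tuple bool := [tuple T (sval (occ s) + k)%N | k < n].
have gI : injective g.
  move=> s s' /(congr1 (fun w => tnth w)) gg; apply: eq_from_tnth => i.
  rewrite !(tnth_nth false); apply: (@word_inj fill e j) => // p pj.
  rewrite -(svalP (occ s)) // -(svalP (occ s')) //.
  have pn := leq_trans pj jn.
  by have /(congr1 (fun h => h (Ordinal pn))) := gg; rewrite !tnth_mktuple.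
have -> : (2 ^ holes fill j = #|[set: (holes fill j).-tuple bool]%SET|)%N.
  by rewrite cardsT card_tuple card_bool.
rewrite -(card_imset _ gI); apply/subset_leq_card/fintype.subsetP => _ /imsetP[s _ ->].
by apply/toeplitz_languageP => //; exists (sval (occ s)) => k; rewrite tnth_mktuple.
Qed.

(** A window of length at most [2 ^ j] meets at most two consecutive aligned blocks, so its offset
    and two fillings determine it. *)
Lemma language_upper j n : toeplitz_shift !=set0 -> (n <= 2 ^ j)%N ->
  (#|language toeplitz_shift n| <= 2 ^ j * 2 ^ (2 * holes fill j))%N.
Proof.
move=> X0 nj; set h := holes fill j.
pose f (s : h.-tuple bool) := nth false s.
pose g (u : 'I_(2 ^ j) * (h.-tuple bool * h.-tuple bool)) : n.-tuple bool :=
  [tuple if (u.1 + k < 2 ^ j)%N then word j (f u.2.1) (u.1 + k)%N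
         else word j (f u.2.2) (u.1 + k - 2 ^ j)%N | k < n].
have -> : (2 ^ j * 2 ^ (2 * h) = #|[set: 'I_(2 ^ j) * (h.-tuple bool * h.-tuple bool)]%SET|)%N.
  by rewrite cardsT !card_prod !card_tuple card_bool card_ord mul2n -addnn expnD.
apply: (leq_trans _ (leq_imset_card g _)).
apply/subset_leq_card/fintype.subsetP => w /toeplitz_languageP -/(_ X0)[ o ho].
have oE := divn_eq o (2 ^ j); have oj := ltn_pmod o (expn_gt0 2 j).
have [s hs] := toeplitz_block fill e j (o %/ 2 ^ j).
have [s' hs'] := toeplitz_block fill e j (o %/ 2 ^ j).+1.
have fE t p : word j (f [tuple t (i : nat) | i < h]) p = word j t p.
  apply: eq_word => i ih; rewrite /f; have := nth_mktuple (fun i : 'I_h => t i) false (Ordinal ih).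
  by move=> /= ->.
apply/imsetP; exists (Ordinal oj, ([tuple s i | i < h], [tuple s' i | i < h])) => //.
apply: eq_from_tnth => k; rewrite tnth_mktuple -ho /= !fE {1}oE.
case: ifPn => [lt|]; first by rewrite -addnA hs.
rewrite -leqNgt => le; rewrite -hs'; last by have := ltn_ord k; lia.
by congr T; rewrite mulSn; lia.
Qed.

End ToeplitzShift.

(** * Pattern frequencies and unique ergodicity *)

Lemma sum_periodic (F : int -> nat) (M : nat) : (forall m, F (m + M%:Z) = F m) ->
  forall m, (\sum_(0 <= p < M) F (m + p%:Z)%R = \sum_(0 <= p < M) F p%:Z)%N.
Proof.
move=> perF; have S m : (\sum_(0 <= p < M) F (m + 1 + p%:Z)%R = \sum_(0 <= p < M) F (m + p%:Z)%R)%N.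
  case: M perF => [|M] perF; first by rewrite !big_geq.
  rewrite big_nat_recr //= big_nat_recl //= addnC; congr addn.
    by rewrite -addrA -intS perF addr0.
  by apply: eq_bigr => i _; rewrite -addrA -intS.
move=> m; have E0 : (\sum_(0 <= p < M) F p%:Z = \sum_(0 <= p < M) F (0 + p%:Z)%R)%N.
  by apply: eq_bigr => p _; rewrite add0r.
elim: m => [|n IH|n IH]; first by [].
- by rewrite -IH -addn1 PoszD S.
- by rewrite -IH -S; apply: eq_bigr => p _; congr F; lia.
Qed.

(* Patterns have arbitrary finite supports, rather than being words, so that
   their cylinders are closed under intersection. *)
Definition pattern := seq (int * bool).

Definition pattern_shift (c : int) (l : pattern) : pattern :=
  [seq (c + u.1, u.2) | u <- l].

Definition cyl (l : pattern) : set (cylT false) :=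
  [set x : config false | all (fun u => x u.1 == u.2) l].

Lemma cylE l (x : config false) : cyl l x = (all (fun u => x u.1 == u.2) l : Prop).
Proof. by []. Qed.

Lemma cyl_shift l : @Defs.shift _ false @^-1` cyl l = cyl (pattern_shift 1 l).
Proof.
apply/funext => x; rewrite /cyl /pattern_shift /= all_map; congr is_true.
by apply: eq_all => u /=; rewrite /Defs.shift addrC.
Qed.

Lemma measurable_coord (i : int) a : measurable ([set x | x i = a] : set (cylT false)).
Proof. by apply: sub_sigma_algebra; exists i, a. Qed.

Lemma measurable_cyl l : measurable (cyl l).
Proof.
elim: l => [|[i a] l IH].
  by rewrite (_ : cyl [::] = setT) //; apply/seteqP; split.
rewrite (_ : cyl _ = [set x : cylT false | x i = a] `&` cyl l).
  by apply: measurableI => //; exact: measurable_coord.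
apply/seteqP; split=> x /=.
  by case/andP => /eqP.
by move=> [/eqP xi xl]; apply/andP.
Qed.

Definition window (N : nat) (f : int -> bool) : pattern :=
  [seq (n, f n) | n <- [seq i%:Z - N%:Z | i <- iota 0 (N + N).+1]].

Lemma mem_window N f u : (u \in window N f) = (`|u.1| <= N%:Z) && (u.2 == f u.1).
Proof.
apply/mapP/andP => [[n /mapP[i] + ->{n}] ->|[uN /eqP ua]].
  by rewrite mem_iota => iN; split=> //=; lia.
exists u.1; last by rewrite -ua; case: u {uN ua}.
apply/mapP; exists (absz (u.1 + N%:Z)); last by move: (u.1) uN => n; lia.
by rewrite mem_iota; move: (u.1) uN => n; lia.
Qed.

Lemma cyl_windowP N f x : cyl (window N f) x <-> forall n : int, `|n| <= N%:Z -> x n = f n.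
Proof.
rewrite cylE; split=> [/allP h n nN|h]; last first.
  by apply/allP => u; rewrite mem_window => /andP[uN /eqP ->]; rewrite h.
by apply/eqP; apply: (h (n, f n)); rewrite mem_window /= nN eqxx.
Qed.

Lemma cyl_cat l l' : cyl (l ++ l') = cyl l `&` cyl l'.
Proof.
apply/seteqP; split=> x /=; rewrite /cyl /= all_cat; first by case/andP.
by move=> [? ?]; apply/andP.
Qed.

(** Replaces the one-coordinate generators by a pi-system, as uniqueness of measures requires. *)
Lemma measurable_cylE : @measurable _ (cylT false) = <<s range cyl >>.
Proof.
apply/seteqP; split; apply: smallest_sub.
- exact: smallest_sigma_algebra.
- move=> _ [i [a ->]]; apply: sub_sigma_algebra; exists [:: (i, a)] => //.
  by apply/seteqP; split=> x /=; rewrite /cyl /= andbT => /eqP.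
- exact: sigma_algebra_measurable.
- by move=> _ [l _ <-]; exact: measurable_cyl.
Qed.

Lemma cyl_measure_unique (R : realType) (P Q : probability (cylT false) R) :
  (forall l, P (cyl l) = Q (cyl l)) -> forall B, measurable B -> P B = Q B.
Proof.
move=> PQ B mB; apply: (measure_unique (range cyl) (fun=> cyl [::])) mB.
- exact: measurable_cylE.
- by move=> _ _ [l _ <-] [l' _ <-]; exists (l ++ l') => //; exact: cyl_cat.
- by move=> _; exists [::].
- by apply/seteqP; split=> // x _; exists 0%N.
- by move=> _ [l _ <-]; exact: PQ.
- by move=> _; rewrite (le_lt_trans (probability_le1 _ (measurable_cyl _))) ?ltry.
Qed.

Section Frequency.
Variables (fill : nat -> bool) (e : nat -> nat -> bool).
Notation T := (toeplitz fill e).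
Notation word := (word fill e).
Notation det := (det fill).
Notation holes := (holes fill).

Definition residue (j : nat) (m : int) : nat := absz (m %% (2 ^ j)%N%:Z)%Z.

Lemma residue_lt j m : (residue j m < 2 ^ j)%N.
Proof. by rewrite /residue; have := expn_gt0 2 j; lia. Qed.

Lemma residue_nat j (k : nat) : residue j k = (k %% 2 ^ j)%N.
Proof. by rewrite /residue modz_nat. Qed.

Lemma residue_period j m : residue j (m + (2 ^ j)%N%:Z) = residue j m.
Proof. by rewrite /residue modzDr. Qed.

Lemma residue_mod j k m m' : (j <= k)%N -> (m = m' %[mod (2 ^ j)%N%:Z])%Z ->
  residue j m = (residue k m' %% 2 ^ j)%N.
Proof.
move=> jk mm; rewrite -residue_nat /residue mm; congr absz.
rewrite gez0_abs ?modz_ge0 //; last by rewrite eqz_nat expn_eq0.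
set K := (2 ^ k)%N%:Z; have KE : K = (2 ^ (k - j))%N%:Z * (2 ^ j)%N%:Z.
  by rewrite -PoszM -expnD subnK.
by rewrite {1}(divz_eq m' K) {2}KE mulrA modzMDl.
Qed.

(** Skeleton [j] is extended with period [2 ^ j]. When [l] placed at [m] avoids all holes ([known]),
    [agrees] tells whether the skeleton forces [l] there. [hits] counts the residues where it does,
    [misses] those where [l] meets a hole. *)
Definition known j (l : pattern) (m : int) := all (fun u => det j (residue j (m + u.1))) l.
Definition agrees j (l : pattern) (m : int) :=
  all (fun u => word j (fun=> false) (residue j (m + u.1)) == u.2) l.
Definition hits j l := (\sum_(0 <= p < 2 ^ j) (known j l p && agrees j l p))%N.
Definition misses j l := (\sum_(0 <= p < 2 ^ j) ~~ known j l p)%N.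

Lemma known_period j l m : known j l (m + (2 ^ j)%N%:Z) = known j l m.
Proof. by apply: eq_all => u; rewrite addrAC residue_period. Qed.

Lemma agrees_period j l m : agrees j l (m + (2 ^ j)%N%:Z) = agrees j l m.
Proof. by apply: eq_all => u; rewrite addrAC residue_period. Qed.

Lemma hits_translate j l m :
  (\sum_(0 <= p < 2 ^ j) (known j l (m + p%:Z)%R && agrees j l (m + p%:Z)%R) = hits j l)%N.
Proof.
by apply: (@sum_periodic (fun m => known j l m && agrees j l m : nat)) => k;
  rewrite known_period agrees_period.
Qed.

Lemma misses_translate j l m :
  (\sum_(0 <= p < 2 ^ j) ~~ known j l (m + p%:Z)%R = misses j l)%N.
Proof.
by apply: (@sum_periodic (fun m => ~~ known j l m : nat)) => k; rewrite known_period.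
Qed.

Lemma known_shift j l c m : known j (pattern_shift c l) m = known j l (c + m).
Proof. by rewrite /known all_map; apply: eq_all => u /=; congr (det _ (residue _ _)); lia. Qed.

Lemma agrees_shift j l c m : agrees j (pattern_shift c l) m = agrees j l (c + m).
Proof.
by rewrite /agrees all_map; apply: eq_all => u /=; congr (word _ _ (residue _ _) == _); lia.
Qed.

Lemma hits_shift j l c : hits j (pattern_shift c l) = hits j l.
Proof.
by rewrite -(hits_translate j l c); apply: eq_bigr => p _; rewrite known_shift agrees_shift.
Qed.

Lemma misses_shift j l c : misses j (pattern_shift c l) = misses j l.
Proof. by rewrite -(misses_translate j l c); apply: eq_bigr => p _; rewrite known_shift. Qed.

(** Union bound: each entry of [l] falls on a hole for exactly [holes j] residues. *)
Lemma misses_le j l : (misses j l <= size l * holes j)%N.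
Proof.
elim: l => [|u l IH]; first by rewrite /misses big1.
rewrite /= mulSn; apply: leq_trans (leq_add (leqnn _) IH).
rewrite -(sum_undet fill j).
have <- : (\sum_(0 <= p < 2 ^ j) ~~ det j (residue j (u.1 + p%:Z)%R)
    = \sum_(0 <= p < 2 ^ j) ~~ det j p)%N.
  rewrite (@sum_periodic (fun m => ~~ det j (residue j m) : nat)).
    by apply: eq_big_nat => p /andP[_ pj]; rewrite residue_nat modn_small.
  by move=> m; rewrite residue_period.
rewrite /misses -big_split; apply: leq_sum => p _ /=.
by rewrite [u.1 + _]addrC; case: (det _ _); case: (known _ _ _).
Qed.

Lemma sum_known j l : (\sum_(0 <= p < 2 ^ j) known j l (Posz p) + misses j l = 2 ^ j)%N.
Proof.
rewrite -big_split /= -[RHS]muln1 -[in RHS](subn0 (2 ^ j)%N) -sum_nat_const_nat.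
by apply: eq_bigr => r _; case: (known _ _ _).
Qed.

Lemma toeplitz_shift_known x j (K : nat) : toeplitz_shift fill e x ->
  exists m : int, forall n : int, `|n| <= K%:Z -> det j (residue j (m + n)) ->
    x n = word j (fun=> false) (residue j (m + n)).
Proof.
move=> Xx; have [ o Ko ho] := Xx K; exists o%:Z => n nK.
have -> : o%:Z + n = absz (o%:Z + n) by lia.
by rewrite ho // residue_nat => /toeplitz_mod ->.
Qed.

(** Along [2 ^ j] consecutive positions each residue occurs once; the skeleton decides whether [l]
    occurs except at the [misses j l] residues where [l] meets a hole. *)
Lemma toeplitz_shift_count x j l : toeplitz_shift fill e x ->
  (hits j l <= \sum_(0 <= p < 2 ^ j) (x \in cyl (pattern_shift p l)) <= hits j l + misses j l)%N.
Proof.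
(* [K] bounds every coordinate of [l], so the window of radius [K + 2 ^ j] contains all the
   translates counted. *)
move=> Xx; pose K := (\sum_(u <- l) absz u.1)%N.
have Kl u : u \in l -> (absz u.1 <= K)%N by move=> ul; rewrite /K (big_rem u) //= leq_addr.
have bound (p M : nat) (i : int) : ((absz i <= K)%N -> (p < M)%N -> `|p%:Z + i| <= (K + M)%N%:Z).
  by clear; move: K => k; lia.
have [m hm] := toeplitz_shift_known _ j (K + 2 ^ j) Xx.
rewrite -(hits_translate j l m) -(misses_translate j l m) -big_split /=.
have E (p : nat) : (p < 2 ^ j)%N -> known j l (m + p) ->
    (x \in cyl (pattern_shift p l)) = agrees j l (m + p).
  move=> pj /allP kn; apply/idP/idP.
    rewrite inE /cyl /= all_map => /allP xl; apply/allP => u ul.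
    have := xl _ ul => /= /eqP <-; rewrite hm; last first.
    - by rewrite addrA; exact: kn.
    - exact/bound/pj/Kl.
    by rewrite addrA.
  move=> /allP ag; rewrite inE /cyl /= all_map; apply/allP => u ul /=.
  rewrite hm; last first.
  - by rewrite addrA; exact: kn.
  - exact/bound/pj/Kl.
  by rewrite addrA; exact: ag.
apply/andP; split; rewrite !big_nat; apply: leq_sum => p /= pj.
  by case: (boolP (known j l (m + p))) => // kn; rewrite E.
by case: (boolP (known j l (m + p))) => [kn|_]; [rewrite E //= addn0|exact: leq_b1].
Qed.

(* Since [misses j l] is o(2 ^ j), this pins v down to at most one value. *)
Definition has_freq (R : realType) (l : pattern) (v : R) :=
  forall j, (hits j l)%:R <= 2 ^+ j * v <= (hits j l + misses j l)%N%:R.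

Hypothesis rich : forall (s : nat -> bool) h k,
  exists j, [/\ (k <= j)%N, fill j & forall i, (i < h)%N -> e j i = s i].

Lemma nfill_unbounded c : exists j, (c <= nfill fill j)%N.
Proof.
elim: c => [|c [j cj]]; first by exists 0%N.
have [k [jk fk _]] := rich (fun=> false) 0 j.
exists k.+1; rewrite /= fk addn1 ltnS (leq_trans cj) //.
by rewrite -(subnK jk); elim: (k - j)%N => //= d IH; rewrite (leq_trans IH) // leq_addr.
Qed.

Lemma misses_small (R : realType) l (eps : R) : 0 < eps ->
  forall J, exists2 j, (J <= j)%N & (misses j l)%:R < 2 ^+ j * eps.
Proof.
move=> e0 J.
(* The bound [J] forces [J <= nfill j <= j]; the other one gives [size l / eps < 2 ^ nfill j], the
   inverse density of the holes. *)
have [j cj] := nfill_unbounded (maxn J (Num.truncn ((size l)%:R / eps)).+1).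
have jn : (nfill fill j <= j)%N by elim: j {cj} => //= j; case: (fill j); lia.
exists j; first by rewrite (leq_trans _ jn) // (leq_trans _ cj) // leq_maxl.
apply: (@le_lt_trans _ _ ((size l)%:R * (holes j)%:R)).
  by rewrite -natrM ler_nat misses_le.
rewrite -natrX -(holes_nfill fill j) natrM mulrC -mulrA ltr_pM2l ?ltr0n ?holes_gt0 //.
rewrite -ltr_pdivrMr // (lt_le_trans (truncnS_gt _)) // ler_nat.
by rewrite (leq_trans (leq_maxr J _)) // (leq_trans cj) // ltnW // ltn_expl.
Qed.

Lemma has_freq_unique (R : realType) l (v w : R) : has_freq R l v -> has_freq R l w -> v = w.
Proof.
wlog vw : v w / v < w.
  move=> H hv hw; have [vw|wv|//] := ltgtP v w; first exact: H.
  exact/esym/H.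
move=> hv hw; have wv0 : 0 < w - v by rewrite subr_gt0.
have [j _] := misses_small R l _ wv0 0.
have /andP[h1 _] := hv j; have /andP[_ h2] := hw j.
by move: h2; rewrite natrD mulrBr => h2; lra.
Qed.

Lemma has_freq_shift (R : realType) l c (v : R) :
  has_freq R (pattern_shift c l) v <-> has_freq R l v.
Proof. by split=> h j; have := h j; rewrite hits_shift misses_shift. Qed.

Definition toeplitz_window (N : nat) : set (cylT false) :=
  \bigcup_(o in [set o | (N <= o)%N]) cyl (window N (fun n => T (absz (o%:Z + n)))).

Lemma measurable_toeplitz_window N : measurable (toeplitz_window N).
Proof. by apply: bigcup_measurable => o _; exact: measurable_cyl. Qed.

Lemma toeplitz_shiftE : toeplitz_shift fill e = \bigcap_N toeplitz_window N.
Proof.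
apply/seteqP; split=> x.
  by move=> Xx N _; have [ o No ho] := Xx N; exists o => //; apply/cyl_windowP.
by move=> h N; have [ o No /cyl_windowP ho] := h N I; exists o.
Qed.

Lemma measurable_toeplitz_shift :
  measurable (toeplitz_shift fill e : set (cylT false)).
Proof.
by rewrite toeplitz_shiftE; apply: bigcapT_measurable; exact: measurable_toeplitz_window.
Qed.

Lemma invariant_has_freq (R : realType) (P : probability (cylT false) R) l :
  invariant_prob (toeplitz_shift fill e) P -> has_freq R l (fine (P (cyl l))).
Proof.
move=> [PX Pinv] j; set X : set (cylT false) := toeplitz_shift fill e in PX *.
have mX : measurable X := measurable_toeplitz_shift.
have Pfin A : measurable A -> P A \is a fin_num by move=> mA; exact: fin_num_measure.
(* The pointwise count holds only on [X]; as the complement of [X] is null, integrating over [X]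
   loses nothing. *)
have PI (A : set (cylT false)) : measurable A -> P (A `&` X) = P A.
  move=> mA; apply/eqP; rewrite eq_le le_measure ?inE //=; try exact: measurableI.
  have mXC : measurable (~` X) by exact: measurableC.
  have : (P A <= P (A `&` X) + P (A `&` ~` X))%E.
    rewrite -measureU; last 3 first.
    - exact: measurableI.
    - exact: measurableI.
    - by rewrite setIACA setICr setI0.
    by rewrite -setIUr setUv setIT.
  have -> : P (A `&` ~` X) = 0%E; last by rewrite adde0.
  apply/eqP; rewrite -measure_le0 (@le_trans _ _ (P (~` X))) //.
    by rewrite le_measure ?inE //; exact: measurableI.
  by rewrite probability_setC // PX subee.
have Psh (p : nat) : P (cyl (pattern_shift p l)) = P (cyl l).
  elim: p => [|p IH].
    by congr (P (cyl _)); rewrite -[RHS]map_id; apply: eq_map => -[u a] /=; rewrite add0r.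
  rewrite -IH -[RHS]Pinv; last exact: measurable_cyl.
  rewrite cyl_shift; congr (P (cyl _)); rewrite /pattern_shift -map_comp.
  by apply: eq_map => -[u a] /=; rewrite addrA -intS.
pose f (p : nat) (x : cylT false) := (\1_(cyl (pattern_shift p l)) x : R)%:E.
(* By invariance the expected number of occurrences of l in a window of length
   2 ^ j is 2 ^ j * P (cyl l), while that number is controlled pointwise. *)
have SE : (\int[P]_(x in X) (\sum_(p <- index_iota 0 (2 ^ j)) f p x) = (2 ^+ j * fine (P (cyl l)))%:E)%E.
  rewrite ge0_integral_sum //.
  - rewrite (eq_bigr (fun=> (fine (P (cyl l)))%:E)); last first.
      move=> p _; rewrite fineK; last by apply: Pfin; exact: measurable_cyl.
      apply: etrans (Psh p); apply: etrans (PI _ (measurable_cyl _)).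
      exact: integral_indic mX _ (measurable_cyl _).
    by rewrite sumEFin sumr_const_nat subn0 -natrX mulr_natl.
  - move=> p; apply/measurable_EFinP/measurable_funTS/measurable_indic; exact: measurable_cyl.
  - by move=> p x _; rewrite lee_fin.
have fE x : (\sum_(p <- index_iota 0 (2 ^ j)) f p x =
    (\sum_(0 <= p < 2 ^ j) (x \in cyl (pattern_shift p l)))%N%:R%:E)%E.
  by rewrite sumEFin natr_sum; congr EFin; apply: eq_bigr => p _; rewrite indicE.
have mS : measurable_fun X (fun x => \sum_(p <- index_iota 0 (2 ^ j)) f p x)%E.
  apply: emeasurable_sum => p.
  by apply/measurable_EFinP/measurable_funTS/measurable_indic; exact: measurable_cyl.
have cstE (n : nat) : (\int[P]_(x in X) (cst (n%:R%:E : \bar R) x) = n%:R%:E)%E.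
  by apply: etrans (integral_cst P mX _) _; rewrite -[RHS]mule1; congr mule; exact: PX.
rewrite -!lee_fin -SE -(cstE (hits j l)) -(cstE (_ + _)%N); apply/andP; split.
- apply: ge0_le_integral => //.
  + by move=> x _ /=; rewrite lee_fin ler0n.
  + by move=> x Xx; rewrite fE lee_fin ler_nat; have /andP[] := toeplitz_shift_count _ j l Xx.
- apply: ge0_le_integral => //.
  + by move=> x _; rewrite fE lee_fin ler0n.
  + by move=> x Xx; rewrite fE lee_fin ler_nat; have /andP[] := toeplitz_shift_count _ j l Xx.
Qed.

(** Frequencies leave a single possible value on each cylinder, and cylinders determine the
    measure. *)
Lemma invariant_prob_unique (R : realType) (P Q : probability (cylT false) R) :
  invariant_prob (toeplitz_shift fill e) P -> invariant_prob (toeplitz_shift fill e) Q ->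
  forall B, measurable B -> P B = Q B.
Proof.
move=> iP iQ; apply: cyl_measure_unique => l.
have Pfin (P' : probability (cylT false) R) : P' (cyl l) \is a fin_num.
  by apply: fin_num_measure; exact: measurable_cyl.
rewrite -(fineK (Pfin P)) -(fineK (Pfin Q)); congr EFin.
by apply: (has_freq_unique _ l); exact: invariant_has_freq.
Qed.

End Frequency.

(** * The invariant measure *)

Section Odometer.
Variable R : realType.

(* Left end of the interval of points of [0, 1[ whose first j binary digits,
   read with the least significant digit first, are those of r. *)
Fixpoint odo_left (j r : nat) : R :=
  if j is i.+1 then
    if (r < 2 ^ i)%N then odo_left i r else odo_left i (r - 2 ^ i) + 2 ^- i.+1
  else 0.

(** The cylinder of the odometer formed by the 2-adic integers congruent to [r] modulo [2 ^ j], seen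
    as a dyadic interval. *)
Definition odo (j r : nat) : set R := `[odo_left j r, odo_left j r + 2 ^- j[%classic.

Lemma odoS j r : (r < 2 ^ j.+1)%N -> odo j.+1 r `<=` odo j (r %% 2 ^ j).
Proof.
move=> rj t; rewrite /odo /= !in_itv /=.
have hE : 2 ^- j = 2 ^- j.+1 + 2 ^- j.+1 :> R by rewrite exprSr invfM; lra.
have h0 : 0 < 2 ^- j.+1 :> R by rewrite invr_gt0 exprn_gt0.
case: ltnP => rj'; first by rewrite modn_small // => /andP[-> /=]; lra.
have -> : (r %% 2 ^ j = r - 2 ^ j)%N.
  by rewrite -{1}(subnK rj') modnDr modn_small //; rewrite expnS in rj; lia.
by move=> /andP[]; lra.
Qed.

Lemma odo_nested j k r : (j <= k)%N -> (r < 2 ^ k)%N -> odo k r `<=` odo j (r %% 2 ^ j).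
Proof.
move=> jk; rewrite -(subnK jk); elim: (k - j)%N r => [|d IH] r rk.
  by rewrite modn_small.
apply: subset_trans (odoS _ _ rk) _; apply: subset_trans (IH _ _) _.
  by rewrite ltn_pmod // expn_gt0.
by rewrite modn_dvdm // dvdn_exp2l // leq_addl.
Qed.

Lemma odo_inj j r r' t : (r < 2 ^ j)%N -> (r' < 2 ^ j)%N -> odo j r t -> odo j r' t -> r = r'.
Proof.
elim: j r r' => [|j IH] r r' rj rj' rt rt'; first by move: rj rj'; rewrite !ltnS !leqn0 => /eqP-> /eqP->.
have h0 : 0 < 2 ^- j.+1 :> R by rewrite invr_gt0 exprn_gt0.
have mE : (r %% 2 ^ j = r' %% 2 ^ j)%N.
  by apply: IH; [exact/ltn_pmod/expn_gt0|exact/ltn_pmod/expn_gt0|exact: odoS rt|exact: odoS rt'].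
wlog rr' : r r' rj rj' rt rt' mE / (r <= r')%N.
  by move=> H; case: (leqP r r') => [|/ltnW] rr'; [exact: H|apply/esym/H].
have subE s : (2 ^ j <= s)%N -> (s < 2 ^ j.+1)%N -> (s - 2 ^ j = s %% 2 ^ j)%N.
  by move=> js sj; rewrite -{2}(subnK js) modnDr modn_small //; rewrite expnS in sj; lia.
case: (ltnP r (2 ^ j)) => rlt; case: (ltnP r' (2 ^ j)) => rlt'.
- by move: mE; rewrite !modn_small.
- move: rt rt'; rewrite /odo /= !in_itv /= rlt ltnNge rlt' /= subE // -mE (modn_small rlt).
  by move=> /andP[_ h] /andP[h' _]; exfalso; clear -h0 h h'; lra.
- by have := leq_trans rlt rr'; lia.
- by have := subE _ rlt rj; have := subE _ rlt' rj'; lia.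
Qed.

Lemma odo_sub01 j r : (r < 2 ^ j)%N -> odo j r `<=` `[0, 1[.
Proof.
move=> rj; apply: subset_trans (odo_nested 0 j r (leq0n j) rj) _.
by rewrite /odo /= add0r invr1.
Qed.

Lemma measurable_odo j r : measurable (odo j r).
Proof. exact: measurable_itv. Qed.

Definition unif : probability _ R := uniform_prob (@ltr01 R).

Lemma unif_odo j r : (r < 2 ^ j)%N -> unif (odo j r) = (2 ^- j)%:E.
Proof.
move=> rj; have h0 : 0 < 2 ^- j :> R by rewrite invr_gt0 exprn_gt0.
rewrite /unif /= /uniform_prob integral_uniform_pdf setIidl; last first.
  by apply: subset_trans (odo_sub01 _ _ rj) _ => t /=; rewrite !in_itv /= => /andP[-> /ltW].
rewrite (eq_integral (cst 1%E)); last first.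
  move=> t; rewrite inE => /(odo_sub01 _ _ rj) /=; rewrite in_itv /= => /andP[t0 t1].
  by rewrite /uniform_pdf t0 (ltW t1) /= subr0 invr1.
rewrite integral_cst ?mul1e /odo; last exact: measurable_itv.
by rewrite /= lebesgue_measure_itv /= lte_fin ltrDl h0 -EFinD addrAC subrr add0r.
Qed.

Lemma unif_ge_odo (E : set R) j (b : nat -> bool) : measurable E ->
  (forall r, (r < 2 ^ j)%N -> b r -> odo j r `<=` E) ->
  ((2 ^- j * (\sum_(0 <= r < 2 ^ j) b r)%N%:R)%:E <= unif E)%E.
Proof.
move=> mE bE; pose U := \big[setU/set0]_(r < 2 ^ j | b r) odo j r.
have mU : measurable U by apply: bigsetU_measurable => r _; exact: measurable_odo.
have UE : U `<=` E by rewrite /U; elim/big_ind: _ => // [A B AE BE t [/AE|/BE]//|r br]; exact: bE.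
apply: le_trans (_ : unif U <= _)%E; last by rewrite le_measure ?inE.
rewrite /U measure_bigsetU_ord_cond; last 2 first.
- by move=> r _; exact: measurable_odo.
- by move=> r r' _ _ [t [rt rt']]; apply/val_inj; exact: (odo_inj j r r' t (ltn_ord r) (ltn_ord r') rt rt').
rewrite (eq_bigr (fun=> (2 ^- j)%:E)); last by move=> r _; exact: unif_odo.
rewrite sumEFin lee_fin big_mkord natr_sum mulr_sumr [leRHS]big_mkcond /=.
by apply: ler_sum => r _; case: (b r); rewrite ?mulr1 ?mulr0.
Qed.

End Odometer.

Lemma measurable_fun_cylT d (S : measurableType d) (f : S -> cylT false) :
  (forall i, measurable [set t | f t i = true]) -> measurable_fun setT f.
Proof.
move=> mf; apply: (@measurability _ _ S (cylT false) setT f (@cylinders _ false)) => //.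
move=> _ [_ [i [a ->]] <-]; rewrite setTI; case: a; first exact: mf.
rewrite (_ : _ @^-1` _ = ~` [set t | f t i = true]); first exact/measurableC/mf.
by apply/seteqP; split=> t /=; case: (f t i).
Qed.

Lemma measurable_shift : measurable_fun setT (@Defs.shift _ false : cylT false -> cylT false).
Proof. by apply: measurable_fun_cylT => i; exact: measurable_coord. Qed.

(** * The random Toeplitz point and its distribution *)

Section RandomPoint.
Variables (R : realType) (fill : nat -> bool) (e : nat -> nat -> bool).
Notation T := (toeplitz fill e).
Notation word := (word fill e).
Notation det := (det fill).

(* The Toeplitz sequence seen from the odometer point t; undetermined entries
   get the junk value false. *)
Definition random_point (t : measurableTypeR R) : cylT false :=
  fun n => `[< exists j r, [/\ (r < 2 ^ j)%N, odo R j r t,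
    det j (residue j (r%:Z + n)) & word j (fun=> false) (residue j (r%:Z + n))] >].

(** Consistency between levels: the level [k] residue reduces to the level [j] one, and a letter
    fixed by skeleton [j] survives in every later filling. Hence [random_point] may be read at any
    level that determines the entry. *)
Lemma word_odo j k r r' n t s s' : (j <= k)%N -> (r < 2 ^ j)%N -> (r' < 2 ^ k)%N ->
  odo R j r t -> odo R k r' t -> det j (residue j (r%:Z + n)) ->
  word k s (residue k (r'%:Z + n)) = word j s' (residue j (r%:Z + n)).
Proof.
move=> jk rj rk rt rt'.
have rE : r = (r' %% 2 ^ j)%N.
  by apply: (odo_inj R j _ _ t) => //; [exact/ltn_pmod/expn_gt0|exact: (odo_nested R j k)].
have -> : residue j (r%:Z + n) = (residue k (r'%:Z + n) %% 2 ^ j)%N.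
  by apply: residue_mod => //; rewrite rE -modz_nat modzDml.
have [s'' ->] := word_block_mod fill e j k s _ jk (residue_lt k (r'%:Z + n)).
exact: word_det.
Qed.

Lemma random_pointE j r n t : (r < 2 ^ j)%N -> odo R j r t -> det j (residue j (r%:Z + n)) ->
  random_point t n = word j (fun=> false) (residue j (r%:Z + n)).
Proof.
move=> rj rt dr; apply/asboolP/idP => [[k [r' [rk rt' dr' wr']]]|wr]; last by exists j, r.
have [jk|/ltnW kj] := leqP j k.
  by rewrite -(word_odo j k r r' n t (fun=> false)).
by rewrite (word_odo k j r' r n t _ (fun=> false)).
Qed.

Lemma measurable_random_point : measurable_fun setT random_point.
Proof.
apply: measurable_fun_cylT => i.
rewrite (_ : [set _ | _] = \bigcup_j \bigcup_(r in [set r | [&& (r < 2 ^ j)%N,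
    det j (residue j (r%:Z + i)) & word j (fun=> false) (residue j (r%:Z + i))]]) odo R j r).
  by apply: bigcupT_measurable => j; apply: bigcup_measurable => r _; exact: measurable_odo.
apply/seteqP; split=> t.
  by move=> /asboolP[j [r [rj rt dr wr]]]; exists j => //; exists r => //; apply/and3P.
by move=> [j _ [r /and3P[rj dr wr] rt]]; apply/asboolP; exists j, r.
Qed.

HB.instance Definition _ := isMeasurableFun.Build _ _ _ _ random_point measurable_random_point.

Definition toeplitz_prob : probability (cylT false) R :=
  distribution (unif R) random_point.

Lemma toeplitz_probE A : toeplitz_prob A = unif R (random_point @^-1` A).
Proof. by []. Qed.

Lemma measurable_random_pointI A : measurable A -> measurable (random_point @^-1` A).
Proof. by move=> mA; rewrite -[X in measurable X]setTI; exact: measurable_random_point. Qed.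

(** The selected intervals are disjoint, each of measure [2 ^- j]. *)
Lemma toeplitz_prob_ge A j (b : nat -> bool) : measurable A ->
  (forall r, (r < 2 ^ j)%N -> b r -> odo R j r `<=` random_point @^-1` A) ->
  ((\sum_(0 <= r < 2 ^ j) b r)%N%:R <= 2 ^+ j * fine (toeplitz_prob A)).
Proof.
move=> mA bA; have h0 : 0 < 2 ^+ j :> R by rewrite exprn_gt0.
have := unif_ge_odo R _ j b (measurable_random_pointI _ mA) bA.
rewrite -toeplitz_probE -[toeplitz_prob A]fineK; last exact: fin_num_measure.
by rewrite lee_fin -(ler_pM2l h0) mulrA divff ?mul1r // gt_eqF.
Qed.

Lemma random_point_cyl l j r : (r < 2 ^ j)%N -> known fill j l r ->
  odo R j r `<=` [set t | cyl l (random_point t) = agrees fill e j l r].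
Proof.
move=> rj /allP kn t rt; rewrite /= cylE; congr is_true.
by apply: eq_in_all => u ul; rewrite (random_pointE j r) //; exact: kn.
Qed.

(** The residues where the skeleton forces [l] bound the probability from below; those where it
    excludes [l] without meeting a hole bound the complement from below. The remaining residues are
    the misses. *)
Lemma toeplitz_prob_has_freq l : has_freq fill e R l (fine (toeplitz_prob (cyl l))).
Proof.
move=> j; have mC := measurable_cyl l; apply/andP; split.
  apply: toeplitz_prob_ge => // r rj /andP[kn ag] t rt.
  by have /= -> := random_point_cyl _ _ _ rj kn t rt.
pose miss r := known fill j l (Posz r) && ~~ agrees fill e j l (Posz r).
have fin : toeplitz_prob (cyl l) \is a fin_num by exact: fin_num_measure.
have PC : fine (toeplitz_prob (~` cyl l)) = 1 - fine (toeplitz_prob (cyl l)).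
  by rewrite -[RHS]/(fine (1 - fine (toeplitz_prob (cyl l)))%:E) EFinB fineK //;
    congr fine; exact: probability_setC.
have : (\sum_(0 <= r < 2 ^ j) miss r)%N%:R <= 2 ^+ j * fine (toeplitz_prob (~` cyl l)).
  apply: toeplitz_prob_ge => [|r rj /andP[kn nag] t rt]; first exact: measurableC.
  by rewrite /= (random_point_cyl _ _ _ rj kn t rt); exact/negP.
have : (\sum_(0 <= r < 2 ^ j) miss r + (hits fill e j l + misses fill j l) = 2 ^ j)%N.
  rewrite -!big_split /= -[RHS]muln1 -[in RHS](subn0 (2 ^ j)%N) -sum_nat_const_nat.
  by apply: eq_bigr => r _; rewrite /miss; case: (known _ _ _ _); case: (agrees _ _ _ _ _).
by move=> /(congr1 (fun n => n%:R : R)); rewrite natrD natrX PC mulrBr mulr1; lra.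
Qed.

Hypothesis rich : forall (s : nat -> bool) h k,
  exists j, [/\ (k <= j)%N, fill j & forall i, (i < h)%N -> e j i = s i].

(** If the window around residue [r] avoids the holes of skeleton [j], its content also occurs in
    [T]. The proportion of other residues can be made smaller than any [eps]. *)
Lemma toeplitz_prob_window N : toeplitz_prob (toeplitz_window fill e N) = 1%E.
Proof.
have mW := measurable_toeplitz_window fill e N.
have fin : toeplitz_prob (toeplitz_window fill e N) \is a fin_num by exact: fin_num_measure.
apply/eqP; rewrite eq_le; apply/andP; split; first exact: probability_le1.
rewrite -(fineK fin) lee_fin; apply/ler_addgt0Pr => eps e0.
pose l := window N (fun=> false).
have [j Nj hj] := misses_small fill e rich R l eps e0 N.
have h0 : 0 < 2 ^+ j :> R by rewrite exprn_gt0.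
have : (\sum_(0 <= r < 2 ^ j) known fill j l (Posz r))%N%:R <=
    2 ^+ j * fine (toeplitz_prob (toeplitz_window fill e N)).
  apply: toeplitz_prob_ge => // r rj /allP kn t rt.
  (* Adding one period keeps the residue and makes the offset at least [N], since
     [N <= j < 2 ^ j]. *)
  exists (r + 2 ^ j)%N; first by rewrite /= (leq_trans Nj) // ltnW // ltn_addl // ltn_expl.
  apply/cyl_windowP => n nN.
  have dn : det j (residue j (r%:Z + n)) by apply: (kn (n, false)); rewrite mem_window /= nN eqxx.
  have N2 : (N < 2 ^ j)%N by rewrite (leq_ltn_trans Nj) // ltn_expl.
  have rE : residue j (r%:Z + n) = (absz ((r + 2 ^ j)%N%:Z + n)%R %% 2 ^ j)%N.
    rewrite -residue_nat -residue_period; congr residue.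
    by move: (2 ^ j)%N N2 nN => M; clear; lia.
  by rewrite (random_pointE j r) // (toeplitz_mod _ _ j) -rE.
have : (\sum_(0 <= r < 2 ^ j) known fill j l (Posz r) + misses fill j l = 2 ^ j)%N.
  exact: sum_known.
move=> /(congr1 (fun n => n%:R : R)); rewrite natrD natrX => E1 E2.
by rewrite -(ler_pM2l h0) mulr1 mulrDr; lra.
Qed.

Lemma toeplitz_prob_shift : toeplitz_prob (toeplitz_shift fill e) = 1%E.
Proof.
have mX := measurable_toeplitz_shift fill e.
have fin : toeplitz_prob (toeplitz_shift fill e) \is a fin_num by exact: fin_num_measure.
suff : toeplitz_prob (~` toeplitz_shift fill e) = 0%E.
  by rewrite probability_setC // -(fineK fin) -EFinB => -[] ?; congr EFin; lra.
apply/negligibleP; first exact: measurableC.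
rewrite toeplitz_shiftE setC_bigcap; apply: negligible_bigcup => N.
have mW := measurable_toeplitz_window fill e N.
apply/negligibleP; first exact: measurableC.
by apply: etrans (probability_setC _ mW) _; rewrite toeplitz_prob_window subee.
Qed.

(** A pattern and its translate have the same hits and misses, so their probabilities obey the same
    bounds, which admit only one value. *)
Lemma toeplitz_prob_invariant : invariant_prob (toeplitz_shift fill e) toeplitz_prob.
Proof.
split; first exact: toeplitz_prob_shift.
pose S : {mfun cylT false >-> cylT false} := mfun_Sub (mem_set measurable_shift).
(* As the image measure under the shift is itself a probability, comparing on cylinders is
   enough. *)
pose Q : probability (cylT false) R := distribution toeplitz_prob S.
have QE A : Q A = toeplitz_prob (@Defs.shift _ false @^-1` A) by [].
move=> B mB; rewrite -QE; apply: cyl_measure_unique mB => l.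
have fin (l' : pattern) : toeplitz_prob (cyl l') \is a fin_num.
  by apply: fin_num_measure; exact: measurable_cyl.
rewrite QE cyl_shift -(fineK (fin _)) -[RHS](fineK (fin _)); congr EFin.
apply: (has_freq_unique fill e rich R l); last exact: toeplitz_prob_has_freq.
by apply/(has_freq_shift fill e R l 1); exact: toeplitz_prob_has_freq.
Qed.

(** A set of probability one is not empty; no point has to be exhibited. *)
Lemma toeplitz_shift_nonempty : toeplitz_shift fill e !=set0.
Proof.
apply/set0P/eqP => X0; have := toeplitz_prob_shift; rewrite X0.
by move=> /(etrans (esym (measure0 _))) [] /eqP; rewrite eq_sym oner_eq0.
Qed.

Lemma toeplitz_strictly_ergodic : strictly_ergodic R (toeplitz_shift fill e).
Proof.
split; first exact: toeplitz_shift_minimal toeplitz_shift_nonempty.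
split; first by exists toeplitz_prob; exact: toeplitz_prob_invariant.
exact: invariant_prob_unique.
Qed.

End RandomPoint.

(** * Choice of the skeletons *)

Section Growth.
Variables (R : realType) (alpha : R).
Hypotheses (alpha0 : 0 < alpha) (alpha1 : alpha < 1).

Definition slope (j : nat) : nat := Num.truncn (alpha * j%:R).
Definition flat (j : nat) : bool := slope j.+1 == slope j.

Lemma slope_bounds j : (slope j)%:R <= alpha * j%:R < (slope j)%:R + 1.
Proof.
have := @truncn_itv _ (alpha * j%:R); rewrite -natr1; apply.
by rewrite mulr_ge0 ?ler0n // ltW.
Qed.

(** Since [alpha < 1], the integer part of [alpha * j] grows by at most one per step. *)
Lemma slopeS j : slope j.+1 = (slope j + ~~ flat j)%N.
Proof.
have /andP[l1 u1] := slope_bounds j; have /andP[l2 u2] := slope_bounds j.+1.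
move: l2 u2; rewrite -natr1 mulrDr mulr1 => l2 u2.
rewrite /flat; case: eqP => [-> //=|ne]; first by rewrite addn0.
have h1 : (slope j < (slope j.+1).+1)%N.
  by rewrite -(ltr_nat R) -natr1 (le_lt_trans l1) // (lt_trans _ u2) // ltrDl.
have h2 : (slope j.+1 < (slope j).+2)%N.
  by rewrite -(ltr_nat R) -natr1 -natr1 (le_lt_trans l2) // ltrD.
by rewrite addn1; lia.
Qed.

Lemma slope0 : slope 0 = 0%N.
Proof. by rewrite /slope mulr0 truncn0. Qed.

Lemma holes_flat j : holes flat j = (2 ^ slope j)%N.
Proof.
elim: j => [|j IH]; first by rewrite slope0.
by rewrite slopeS /= IH; case: (flat j); rewrite ?addn0 // addn1 expnS mul2n.
Qed.

Lemma nfill_slope j : (nfill flat j + slope j = j)%N.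
Proof. by elim: j => [|j IH]; [rewrite slope0|rewrite slopeS /=; case: (flat j); lia]. Qed.

(** The count [nfill] increases by one exactly after flat levels, and it is unbounded because [nfill
    flat j = j - slope j >= (1 - alpha) * j]; so it takes every value at some flat level. *)
Lemma nfill_flat_onto c : exists2 j, flat j & nfill flat j = c.
Proof.
have [j hj] : exists j, (c < nfill flat j)%N.
  pose j := (Num.truncn (c.+1%:R / (1 - alpha))).+1; exists j.
  have d0 : 0 < 1 - alpha by rewrite subr_gt0.
  have : c.+1%:R < (1 - alpha) * j%:R by rewrite mulrC -ltr_pdivrMr //; exact: truncnS_gt.
  have /andP[+ _] := slope_bounds j; have := congr1 (fun n => n%:R : R) (nfill_slope j).
  rewrite natrD -(ltr_nat R) -natr1 => h1 h2 h3; lra.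
elim: j hj => [//|j IH] /=; case fj: (flat j); last by rewrite addn0 => /IH.
rewrite addn1 ltnS leq_eqVlt => /orP[/eqP ->|/IH//]; by exists j.
Qed.

(* Every m is the 2-adic valuation of infinitely many integers, so every finite
   word is the filling of arbitrarily high levels. *)
Definition filling (j i : nat) : bool :=
  if unpickle (logn 2 (nfill flat j).+1) is Some s then nth false s i else false.

Lemma filling_rich (s : nat -> bool) h k :
  exists j, [/\ (k <= j)%N, flat j & forall i, (i < h)%N -> filling j i = s i].
Proof.
pose m := pickle (mkseq s h).
(* The successor of the count then has 2-adic valuation [m], the code of the word, while the odd
   factor [2k + 1] pushes the level beyond [k]. *)
have [j fj jc] := nfill_flat_onto (k.*2.+1 * 2 ^ m).-1.
have c0 : (0 < k.*2.+1 * 2 ^ m)%N by rewrite muln_gt0 /= expn_gt0.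
exists j; split=> //.
  have : (nfill flat j <= j)%N by rewrite -{2}(nfill_slope j) leq_addr.
  by rewrite jc; move: c0; have := expn_gt0 2 m; move: (2 ^ m)%N => M; nia.
move=> i ih; rewrite /filling jc prednK //.
have -> : logn 2 (k.*2.+1 * 2 ^ m) = m.
  by rewrite logn_Gauss ?pfactorK // coprime2n /= odd_double.
by rewrite pickleK nth_mkseq.
Qed.

(** * Growth of the word counts and the entropy dimension *)

Definition alpha_shift := toeplitz_shift flat filling.

Let X0 : alpha_shift !=set0 := toeplitz_shift_nonempty R flat filling filling_rich.

Let ln2_ge0 : 0 <= ln 2 :> R.
Proof. by rewrite ln_ge0 // ler1n. Qed.

Let ln2X k : ln (2 ^+ k) = k%:R * ln 2 :> R.
Proof. by rewrite lnXn // mulr_natl. Qed.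

Lemma ln_language_lower n : (0 < n)%N ->
  ln 2 / 4 * n%:R `^ alpha <= ln (#|language alpha_shift n|%:R : R).
Proof.
move=> n0; have /andP[jn nj] := trunc_log_bounds (isT : (1 < 2)%N) n0.
set j := trunc_log 2 n in jn nj.
have := language_lower _ _ filling_rich j n X0 jn; rewrite holes_flat => L.
have L' : ln (2 ^+ (2 ^ slope j) : R) <= ln (#|language alpha_shift n|%:R : R).
  rewrite ler_ln ?posrE ?exprn_gt0 // -?natrX ?ler_nat //.
  by rewrite ltr0n (leq_trans _ L) // expn_gt0.
apply: le_trans L'; rewrite ln2X.
(* The factor 4 comes from [n < 2 ^ (j + 1)] and [alpha * (j + 1) < slope j + 1 + alpha < slope j +
   2]. *)
suff /(ler_wpM2l ln2_ge0) : n%:R `^ alpha <= (2 ^ slope j)%N%:R * 4 by lra.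
have -> : (2 ^ slope j)%N%:R * 4 = 2 `^ ((slope j)%:R + 2%:R) :> R.
  rewrite powRD ?pnatr_eq0 ?implybT // !powR_mulrn // natrX expr2; lra.
apply: (@le_trans _ _ ((2 `^ j.+1%:R) `^ alpha)).
  by rewrite ge0_ler_powR ?nnegrE ?powR_ge0 ?ler0n // ?ltW // powR_mulrn // -natrX ltr_nat.
rewrite -powRrM ler_powR ?ler1n //.
by have /andP[_] := slope_bounds j; move: alpha1; rewrite -natr1; lra.
Qed.

Lemma ln_language_upper n : (0 < n)%N ->
  ln (#|language alpha_shift n|%:R : R) <= (2 / alpha + 4) * n%:R `^ alpha.
Proof.
move=> n0; have /andP[jn nj] := trunc_log_bounds (isT : (1 < 2)%N) n0.
set J := (trunc_log 2 n).+1 in nj.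
have := language_upper _ _ filling_rich J n X0 (ltnW nj); rewrite holes_flat => L.
have L0 : (0 < #|language alpha_shift n|)%N.
  apply: leq_trans (language_lower _ _ filling_rich _ n X0 jn); exact: expn_gt0.
have L' : ln (#|language alpha_shift n|%:R : R) <= ln (2 ^+ (J + 2 * 2 ^ slope J)).
  by rewrite ler_ln ?posrE ?exprn_gt0 ?ltr0n // -natrX ler_nat expnD.
apply: le_trans L' _; rewrite ln2X.
have le1 : ln 2 <= 1 :> R.
  by rewrite -ler_expR lnK ?posrE //; have := @expR_ge1Dx R 1; lra.
set N := n%:R `^ alpha.
(* Here [2 ^ J <= 2 * n], and [2 ^ alpha <= 2]. *)
have hN : 2 `^ (alpha * J%:R) <= 2 * N.
  apply: (@le_trans _ _ ((2 * n%:R) `^ alpha)).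
    have hJ : 2 `^ J%:R <= 2 * n%:R :> R.
      by rewrite powR_mulrn // exprS -natrX ler_pM2l ?ltr0n // ler_nat.
    rewrite mulrC powRrM; apply: ge0_ler_powR hJ; first exact: ltW.
    - by rewrite nnegrE powR_ge0.
    - by rewrite nnegrE mulr_ge0 ?ler0n.
  rewrite powRM ?ler0n // ler_wpM2r ?powR_ge0 //.
  by rewrite ler1_powR ?ler1n // ltW.
have h1 : (2 ^ slope J)%N%:R <= 2 * N.
  apply: le_trans hN; rewrite natrX -powR_mulrn // ler_powR ?ler1n //.
  by have /andP[] := slope_bounds J.
(* The offsets contribute only [J * ln 2], absorbed through [x <= exp x] at [x = alpha * J * ln 2],
   whence the [2 / alpha]. *)
have h2 : J%:R * ln 2 <= 2 / alpha * N.
  rewrite mulrAC ler_pdivlMr // -mulrA [_ * alpha]mulrC.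
  apply: le_trans hN; rewrite /powR pnatr_eq0 /= mulrCA mulrA.
  by apply: le_trans (expR_ge1Dx _); rewrite lerDr.
rewrite natrD mulrDl mulrDl lerD // natrM.
apply: (@le_trans _ _ (2 * (2 ^ slope J)%N%:R)); last by lra.
by rewrite ler_piMr ?mulr_ge0 ?ler0n.
Qed.

Lemma cvg_natr_powR (g : R) : 0 < g -> n%:R `^ g @[n --> \oo] --> +oo.
Proof.
move=> g0; apply/cvgryPge => A; exists (Num.truncn (`|A| `^ g^-1)).+1 => // n /= hn.
apply: le_trans (ler_norm A) _.
have -> : `|A| = (`|A| `^ g^-1) `^ g by rewrite -powRrM mulVf ?powRr1 // lt0r_neq0.
apply: ge0_ler_powR; rewrite ?nnegrE ?powR_ge0 ?ler0n //; first exact: ltW.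
by apply: le_trans (ltW (truncnS_gt _)) _; rewrite ler_nat.
Qed.

Lemma cplx_ratio_cvgy (beta : R) : 0 < beta -> beta < alpha ->
  cplx_ratio alpha_shift beta @ \oo --> +oo%E.
Proof.
move=> b0 ba; apply/cvgeryP/cvgryPge => A.
have c0 : 0 < ln 2 / 4 :> R by rewrite divr_gt0 // ln_gt0 // ltr1n.
have ab : 0 < alpha - beta by rewrite subr_gt0.
have /cvgryPge/(_ (A / (ln 2 / 4))) := cvg_natr_powR _ ab.
move=> H; near=> n; have n0 : (0 < n)%N by near: n; exists 1%N.
rewrite ler_pdivlMr ?powR_gt0 ?ltr0n //; apply: le_trans (ln_language_lower _ n0).
have : A / (ln 2 / 4) <= n%:R `^ (alpha - beta) by near: n.
rewrite ler_pdivrMr // powRB; last by rewrite pnatr_eq0 -lt0n n0 implybT.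
by rewrite mulrAC ler_pdivlMr ?powR_gt0 ?ltr0n // [_ * (ln 2 / 4)]mulrC.
Unshelve. all: by end_near.
Qed.

Lemma cplx_ratio_cvg0 (beta : R) : alpha < beta ->
  cplx_ratio alpha_shift beta @ \oo --> 0%E.
Proof.
move=> ab; apply: cvg_EFin; first by apply: nearW.
apply/cvgr0Pnorm_le => eps e0.
have ba : 0 < beta - alpha by rewrite subr_gt0.
have /cvgryPge/(_ ((2 / alpha + 4) / eps)) := cvg_natr_powR _ ba.
move=> H; near=> n; have n0 : (0 < n)%N by near: n; exists 1%N.
have lo := ln_language_lower _ n0; have up := ln_language_upper _ n0.
have L0 : 0 <= ln (#|language alpha_shift n|%:R : R).
  by apply: le_trans lo; rewrite mulr_ge0 ?powR_ge0 // divr_ge0.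
rewrite /= ger0_norm ?divr_ge0 ?powR_ge0 // ler_pdivrMr ?powR_gt0 ?ltr0n //.
apply: le_trans up _.
have : (2 / alpha + 4) / eps <= n%:R `^ (beta - alpha) by near: n.
rewrite ler_pdivrMr // powRB; last by rewrite pnatr_eq0 -lt0n n0 implybT.
by rewrite mulrAC ler_pdivlMr ?powR_gt0 ?ltr0n // [_ * eps]mulrC.
Unshelve. all: by end_near.
Qed.

Lemma alpha_shift_entropy_dim : entropy_dim alpha_shift alpha%:E.
Proof.
split; split=> beta b0; rewrite lte_fin => hb.
- by rewrite (cvg_limn_einf_sup (cplx_ratio_cvgy _ b0 hb)).2.
- by rewrite (cvg_limn_einf_sup (cplx_ratio_cvg0 _ hb)).2.
- by rewrite (cvg_limn_einf_sup (cplx_ratio_cvgy _ b0 hb)).1.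
- by rewrite (cvg_limn_einf_sup (cplx_ratio_cvg0 _ hb)).1.
Qed.

End Growth.

Theorem theorem3p2 (R : realType) (alpha : R) :
  0 < alpha < 1 ->
  exists (A : finType) (a0 : A) (X : set (config a0)),
    strictly_ergodic R X /\ entropy_dim X alpha%:E.
Proof.
move=> /andP[a0 a1]; exists bool, false, (alpha_shift R alpha); split.
  exact/toeplitz_strictly_ergodic/filling_rich.
exact: alpha_shift_entropy_dim.
Qed.
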